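(* For every integer $n\ge 5$ the group $S_n^+$ is isomorphic to the alternating group $A_n$. In other words, for $n\ge 5$ the relations (R1)–(R4) of the context define a stationary local presentation (of depth $3$) of the alternating group: $$A_n\cong S_n^+=\langle x_1,\dots,x_{n-2}\mid \text{(R1)–(R4)}\rangle ,\qquad n\ge 5,$$ and moreover $$A_4\cong S_4^+=\langle x_1,x_2\mid x_1^3=x_2^3=1,\ (x_1x_2)^2=1\rangle .$$
   Context: For an integer $n\ge 2$, $S_n^+$ denotes the group given by generators $x_1,\dots,x_{n-2}$ and the defining relations (R1) $x_i^3=1$ for $1\le i\le n-2$; (R2) $(x_ix_{i+1})^2=1$ for $1\le i\le n-3$; (R3) $x_ix_j=x_jx_i$ for $1\le i,j\le n-2$ with $|i-j|>2$; (R4) $x_ix_{i+1}^{-1}x_{i+2}=x_{i+2}x_i$ for $1\le i\le n-4$. (A family of relations with empty index range is vacuous; for $n=4$ only (R1) and (R2) occur.) Terminology: generators $x_1,\dots,x_m$ of a group are called local of depth $k$ if $x_ix_j=x_jx_i$ whenever $|i-j|>k-1$. They are called stationary if the relations between $x_i,\dots,x_{i+k-1}$ do not depend on $i$, i.e. for each $i$ with $1\le i\le m-k+1$ the map $x_j\mapsto x_{j+i-1}$, $j=1,\dots,k$, extends to an isomorphism from the subgroup generated by $x_1,\dots,x_k$ onto the subgroup generated by $x_i,\dots,x_{i+k-1}$. A presentation on such generators is called a stationary local presentation. *)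

(* Defs.v *)
From HB Require Import structures.
From mathcomp Require Import all_boot all_fingroup ssrint alt.
From mathcomp Require Import boolp classical_sets functions.

Set Implicit Arguments.
Unset Strict Implicit.
Unset Printing Implicit Defensive.

Local Open Scope group_scope.

(* Groups given by generators and relations.  The generators are indexed by   *)
(* I; the letter (i, false) stands for x_i and (i, true) for x_i^-1.          *)
Definition word (I : Type) := seq (I * bool).

Definition ltr {I : Type} (i : I) : I * bool := (i, false).
Definition ltrV {I : Type} (i : I) : I * bool := (i, true).

Section PresentedGroup.
Variables (I : choiceType) (R : word I -> word I -> Prop).
Implicit Types (a : I * bool) (u v w : word I).

Definition inv_ltr a : I * bool := (a.1, ~~ a.2).
Definition inv_word w : word I := rev (map inv_ltr w).

(* R u v is the defining relation u = v; pres_congr is the congruence on      *)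
(* words generated by R and by free cancellation.                             *)
Inductive pres_congr : word I -> word I -> Prop :=
| pres_refl u : pres_congr u u
| pres_sym u v : pres_congr u v -> pres_congr v u
| pres_trans u v w : pres_congr u v -> pres_congr v w -> pres_congr u w
| pres_cancel u a v : pres_congr (u ++ [:: a; inv_ltr a] ++ v) (u ++ v)
| pres_rel u l r v : R l r -> pres_congr (u ++ l ++ v) (u ++ r ++ v).

Definition pres_congrb : rel (word I) := fun u v => `[< pres_congr u v >].

Lemma pres_congrb_refl : reflexive pres_congrb.
Proof. by move=> u; apply/asboolP; apply: pres_refl. Qed.

Lemma pres_congrb_sym : symmetric pres_congrb.
Proof. by move=> u v; apply/asboolP/asboolP; apply: pres_sym. Qed.

Lemma pres_congrb_trans : transitive pres_congrb.
Proof.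
move=> v u w /asboolP uv /asboolP vw; apply/asboolP.
exact: pres_trans uv vw.
Qed.

Canonical pres_equiv : equiv_rel (word I) :=
  EquivRel pres_congrb pres_congrb_refl pres_congrb_sym pres_congrb_trans.

Definition presented : Type := {eq_quot pres_equiv}%qT.

HB.instance Definition _ := Choice.on presented.
HB.instance Definition _ := Quotient.on presented.

Definition pres_class w : presented := (\pi_presented w)%qT.

Lemma pres_classP u v : pres_class u = pres_class v <-> pres_congr u v.
Proof.
split; last by move=> uv; apply/eqmodP; apply/asboolP.
by move/eqmodP/asboolP.
Qed.

Lemma pres_reprK (x : presented) : pres_class (generic_quotient.repr x) = x.
Proof. exact: reprK. Qed.

Lemma pres_congr_ctx p s u v :
  pres_congr u v -> pres_congr (p ++ u ++ s) (p ++ v ++ s).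
Proof.
elim=> {u v} [u|u v _ uv|u v w _ uv _ vw|u a v|u l r v lr].
- exact: pres_refl.
- exact: pres_sym.
- exact: pres_trans uv vw.
- by have := pres_cancel (p ++ u) a (v ++ s); rewrite !catA.
- by have := pres_rel (p ++ u) (v ++ s) lr; rewrite !catA.
Qed.

Lemma inv_ltrK : involutive inv_ltr.
Proof. by case=> i b; rewrite /inv_ltr /= negbK. Qed.

Lemma inv_wordK : involutive inv_word.
Proof. by move=> w; rewrite /inv_word map_rev revK mapK //; exact: inv_ltrK. Qed.

Lemma pres_congrVr w : pres_congr (w ++ inv_word w) [::].
Proof.
elim/last_ind: w => [|w a IHw]; first exact: pres_refl.
rewrite /inv_word map_rcons rev_rcons -/(inv_word w) -cats1 -catA.
exact: pres_trans (pres_cancel w a _) IHw.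
Qed.

Definition pres_mul (x y : presented) := pres_class (generic_quotient.repr x ++ generic_quotient.repr y).
Definition pres_one := pres_class [::].
Definition pres_inv (x : presented) := pres_class (inv_word (generic_quotient.repr x)).

Lemma pres_class_cat u v :
  pres_mul (pres_class u) (pres_class v) = pres_class (u ++ v).
Proof.
apply/pres_classP.
have /pres_classP/(pres_congr_ctx [::] (generic_quotient.repr (pres_class v))) /= uE :=
  pres_reprK (pres_class u).
have /pres_classP/(pres_congr_ctx u [::]) := pres_reprK (pres_class v).
by rewrite !cats0; apply: pres_trans.
Qed.

Lemma pres_mulA : associative pres_mul.
Proof.
move=> x y z; rewrite -(pres_reprK x) -(pres_reprK y) -(pres_reprK z).
by rewrite !pres_class_cat catA.
Qed.

Lemma pres_mul1 : left_id pres_one pres_mul.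
Proof. by move=> x; rewrite -(pres_reprK x) pres_class_cat. Qed.

Lemma pres_mulr1 : right_id pres_one pres_mul.
Proof. by move=> x; rewrite -(pres_reprK x) pres_class_cat cats0. Qed.

Lemma pres_mulrV : right_inverse pres_one pres_inv pres_mul.
Proof.
move=> x; rewrite -[X in pres_mul X](pres_reprK x) pres_class_cat.
exact/pres_classP/pres_congrVr.
Qed.

Lemma pres_mulV : left_inverse pres_one pres_inv pres_mul.
Proof.
move=> x; rewrite -[X in pres_mul _ X](pres_reprK x) pres_class_cat.
apply/pres_classP; rewrite -[X in _ ++ X]inv_wordK; exact: pres_congrVr.
Qed.

HB.instance Definition _ := isGroup.Build presented
  pres_mulA pres_mul1 pres_mulr1 pres_mulV pres_mulrV.

Definition pres_gen (i : I) : presented := pres_class [:: ltr i].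

End PresentedGroup.

Definition isomorphic (G H : groupType) : Prop :=
  exists f : {multiplicative G -> H}, bijective f.

(* Generators are indexed from 0: x_1, ..., x_m are x i for i : 'I_m.         *)
Section StationaryLocal.
Variables (G : groupType) (m : nat).
Implicit Types (x : 'I_m -> G) (k : nat).

Definition is_subgroup (H : set G) : Prop :=
  H 1 /\ forall a b, H a -> H b -> H (a * b^-1).

Definition gen_subgroup (A : set G) : set G := smallest is_subgroup A.

Definition local_gens k x : Prop :=
  forall i j : 'I_m, (k - 1 < `|i - j|)%N -> x i * x j = x j * x i.

Definition window x k i : set G :=
  [set x j | j in [set j : 'I_m | (i <= j < i + k)%N]]%classic.

(* The isomorphism between the two subgroups is represented by a function on  *)
(* all of G, of which only the values on the source subgroup matter.          *)
Definition stationary_gens k x : Prop :=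
  forall i : nat, (i + k <= m)%N ->
  exists f : G -> G,
    [/\ forall a b, gen_subgroup (window x k 0) a ->
          gen_subgroup (window x k 0) b -> f (a * b) = f a * f b,
        set_bij (gen_subgroup (window x k 0)) (gen_subgroup (window x k i)) f
      & forall j j' : 'I_m, (j < k)%N -> j' = (j + i)%N :> nat ->
          f (x j) = x j'].

End StationaryLocal.

Definition stationary_local_presentation (k m : nat)
    (R : word 'I_m -> word 'I_m -> Prop) : Prop :=
  local_gens k (@pres_gen _ R) /\ stationary_gens k (@pres_gen _ R).

Inductive Splus_rel (n : nat) : word 'I_(n - 2) -> word 'I_(n - 2) -> Prop :=
| Splus_R1 (i : 'I_(n - 2)) :
    Splus_rel [:: ltr i; ltr i; ltr i] [::]
| Splus_R2 (i j : 'I_(n - 2)) : j = i.+1 :> nat ->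
    Splus_rel [:: ltr i; ltr j; ltr i; ltr j] [::]
| Splus_R3 (i j : 'I_(n - 2)) : (2 < `|i - j|)%N ->
    Splus_rel [:: ltr i; ltr j] [:: ltr j; ltr i]
| Splus_R4 (i j k : 'I_(n - 2)) : j = i.+1 :> nat -> k = i.+2 :> nat ->
    Splus_rel [:: ltr i; ltrV j; ltr k] [:: ltr k; ltr i].

Definition Splus (n : nat) : groupType := presented (@Splus_rel n).

Inductive A4_rel : word 'I_2 -> word 'I_2 -> Prop :=
| A4_x1_cubed : A4_rel [:: ltr ord0; ltr ord0; ltr ord0] [::]
| A4_x2_cubed : A4_rel [:: ltr ord_max; ltr ord_max; ltr ord_max] [::]
| A4_x1x2_squared :
    A4_rel [:: ltr ord0; ltr ord_max; ltr ord0; ltr ord_max] [::].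

(* Main.v *)
Require Import Defs.
From HB Require Import structures.
From mathcomp Require Import all_boot all_fingroup ssrint alt.
From mathcomp Require Import boolp classical_sets functions.
From mathcomp Require Import zify zmodp.

(* Sending x_i to a 3-cycle on {i, i+1, i+2} defines a morphism phi from      *)
(* S_n^+ to A_n.  Let H_k be the subgroup generated by the first k            *)
(* generators.  The cosets C_(k+2) = H_k, C_(k+1) = H_k x_k and               *)
(* C_j = C_(j+1) x_j (j <= k) are permuted by x_0, ..., x_k exactly as the    *)
(* points 0, ..., k+2 are permuted by the 3-cycles: this follows from         *)
(* (R1)-(R4) by downward induction on j.  Hence an element of H_(k+1) whose   *)
(* image fixes k+2 lies in H_k, so phi is injective by induction on k.        *)
(* Surjectivity follows from the transitivity of H_(k+1) on {0, ..., k+2} by  *)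
(* the same induction.  Stationarity comes from conjugating by a permutation  *)
(* that sends p to p + i for p < 5.                                           *)

Set Implicit Arguments.
Unset Strict Implicit.
Unset Printing Implicit Defensive.

Local Open Scope group_scope.

(** The argument is a coset enumeration. The 3-cycles satisfy (R1)-(R4), which gives phi
    ([Splus_perm]); its kernel and image are then found along the chain of the subgroups H_k.

    Kernel: the generators of H_(k+1) move the listed cosets of H_k as their 3-cycles move the
    points ([point_coset_action_from]), and so do all elements of H_(k+1)
    ([point_coset_gen_action]). If phi g = 1, then H_k g = H_k, so g lies in H_k; descending to the
    trivial H_0 gives g = 1 ([gen_below_faithful]).

    Image: some element of H_(k+1) carries a given point of {0, ..., k+2} to k+2
    ([gen_below_transitive]), so an even permutation of these points is reduced to one that fixes
    k+2 ([even_in_gen_below]).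

    [Splus_perm_bij] joins the two halves for every degree at least 2, so A_4 is covered as well.
    Locality is (R3). For stationarity, conjugation in the symmetric group preserves the even
    permutations and is pulled back through phi to an automorphism of S_n^+ ([Splus_stationary]). *)

(** * Subgroups generated by a set *)

Section GeneratedSubgroup.
Variable G : groupType.
Implicit Types A B : set G.

Lemma subgroupM (H : set G) a b : is_subgroup H -> H a -> H b -> H (a * b).
Proof.
case=> H1 HF Ha Hb; have HVb : H b^-1 by rewrite -div1g; exact: HF.
by rewrite -[b]invgK; exact: HF.
Qed.

Lemma subgroupV (H : set G) a : is_subgroup H -> H a -> H a^-1.
Proof. by case=> H1 HF Ha; rewrite -div1g; exact: HF. Qed.

Lemma gen_subgroup_group A : is_subgroup (gen_subgroup A).
Proof.
split; first by move=> B [[B1 _] _].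
move=> a b Ha Hb B [BG AB]; case: (BG) => _; apply.
  by apply: Ha; split.
by apply: Hb; split.
Qed.

Lemma gen_subgroup_sub A : (A `<=` gen_subgroup A)%classic.
Proof. exact: sub_gen_smallest. Qed.

Lemma gen_subgroup_min A B :
  is_subgroup B -> (A `<=` B)%classic -> (gen_subgroup A `<=` B)%classic.
Proof. exact: smallest_sub. Qed.

Lemma mul_morph1 (K : groupType) (f : G -> K) : {morph f : a b / a * b} -> f 1 = 1.
Proof. by move=> fM; apply: (mulgI (f 1)); rewrite -fM !mulg1. Qed.

Lemma mul_morphV (K : groupType) (f : G -> K) :
  {morph f : a b / a * b} -> {morph f : a / a^-1}.
Proof.
move=> fM a; apply: (mulgI (f a)).
by rewrite -fM !mulgV mul_morph1.
Qed.

Lemma preimage_subgroup (K : groupType) (f : G -> K) (H : set K) :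
  {morph f : a b / a * b} -> is_subgroup H -> is_subgroup (f @^-1` H)%classic.
Proof.
move=> fM [H1 HF]; split; first by rewrite /preimage /= mul_morph1.
by move=> a b /= Ha Hb; rewrite /preimage /= fM mul_morphV //; exact: HF.
Qed.

End GeneratedSubgroup.

(** * Universal property of a presented group *)

Section UniversalProperty.
Variables (I : choiceType) (R : word I -> word I -> Prop) (K : groupType).

Definition word_val (y : I -> K) (w : word I) : K :=
  \prod_(a <- w) (if a.2 then (y a.1)^-1 else y a.1).

Lemma word_val_congr y :
  (forall l r, R l r -> word_val y l = word_val y r) ->
  forall u v, pres_congr R u v -> word_val y u = word_val y v.
Proof.
move=> yR u v; elim=> {u v} // [u v w _ -> _ ->|u a v|u l r v lr] //.
  rewrite /word_val !big_cat /= !big_cons big_nil /=; congr (_ * _).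
  by case: a => i [] /=; rewrite mulg1 ?mulVg ?mulgV mul1g.
by rewrite /word_val !big_cat /= -!/(word_val _ _) (yR _ _ lr).
Qed.

(** Von Dyck's theorem. A class is evaluated on its chosen representative; [word_val_congr] makes
    the choice immaterial. *)
Lemma presented_lift (y : I -> K) :
  (forall l r, R l r -> word_val y l = word_val y r) ->
  exists f : {multiplicative presented R -> K}, forall i, f (pres_gen R i) = y i.
Proof.
move=> yR.
pose f (g : presented R) := word_val y (generic_quotient.repr g).
have fE w : f (pres_class R w) = word_val y w.
  by apply: word_val_congr => //; apply/pres_classP; rewrite pres_reprK.
have fM : {morph f : g h / g * h}.
  move=> g h; rewrite -(pres_reprK g) -(pres_reprK h).
  by rewrite [_ * _]pres_class_cat !fE /word_val big_cat.
pose fmixin := isMultiplicative.Build _ _ f fM.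
pose F : {multiplicative presented R -> K} := HB.pack f fmixin.
exists F => i; rewrite [LHS]fE /word_val big_cons big_nil /=; exact: mulg1.
Qed.

Lemma presented_ind (P : set (presented R)) :
  is_subgroup P -> (forall i, P (pres_gen R i)) -> forall g, P g.
Proof.
move=> PG Pgen g; rewrite -(pres_reprK g); elim: (generic_quotient.repr g) => [|a w IHw].
  by case: PG.
rewrite -cat1s -pres_class_cat; apply: (subgroupM PG) => //.
case: a => i [] /=; last exact: Pgen.
suff <- : (pres_gen R i)^-1 = pres_class R [:: (i, true)].
  by apply: (subgroupV PG); exact: Pgen.
apply: mulg1_eq; rewrite [_ * _]pres_class_cat; apply/pres_classP.
exact: (pres_cancel R [::] (ltr i) [::]).
Qed.

End UniversalProperty.

Lemma presented_rel (I : choiceType) (R : word I -> word I -> Prop) l r :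
  R l r -> word_val (pres_gen R) l = word_val (pres_gen R) r.
Proof.
have valE w : word_val (pres_gen R) w = pres_class R w.
  elim: w => [|[i b] w IHw]; first by rewrite /word_val big_nil.
  rewrite -cat1s -pres_class_cat -IHw /word_val big_cons; congr (_ * _).
  case: b => //=; apply: mulg1_eq; rewrite [_ * _]pres_class_cat; apply/pres_classP.
  exact: (pres_cancel R [::] (ltr i) [::]).
move=> lr; rewrite !valE; apply/pres_classP.
by have := pres_rel [::] [::] lr; rewrite /= !cats0.
Qed.

(* The orientation matters: permutations compose from left to right, and the  *)
(* opposite 3-cycles violate (R4).                                            *)
Definition cycle3 (i p : nat) : nat :=
  if p == i then i.+2 else if p == i.+1 then i else if p == i.+2 then i.+1 else p.

Lemma mul_square1 (G : groupType) (a b : G) :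
  a * b * a * b = 1 -> a * b = b^-1 * a^-1.
Proof. by move=> ab1; rewrite -invgM; symmetry; apply: mulg1_eq; rewrite mulgA. Qed.

Lemma mul_square1V (G : groupType) (a b : G) :
  a * b * a * b = 1 -> b * a = a^-1 * b^-1.
Proof.
move=> ab1; have -> : a^-1 = b * a * b by apply: mulg1_eq; rewrite !mulgA.
by rewrite mulgK.
Qed.

(** * The coset action of the generators *)

Section Cosets.
Variables (G : groupType) (x : nat -> G) (m : nat).

Hypothesis x_cube : forall i, i < m -> x i * x i * x i = 1.
Hypothesis x_mul_square : forall i, i.+1 < m -> x i * x i.+1 * x i * x i.+1 = 1.
Hypothesis x_far_commute : forall i j, i.+2 < j -> j < m -> x i * x j = x j * x i.
Hypothesis x_braid : forall i, i.+2 < m -> x i * (x i.+1)^-1 * x i.+2 = x i.+2 * x i.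

Definition gen_below (k : nat) : set G := gen_subgroup [set x i | i in `I_k]%classic.

Lemma gen_below_group k : is_subgroup (gen_below k).
Proof. exact: gen_subgroup_group. Qed.

Lemma gen_below_gen k i : i < k -> gen_below k (x i).
Proof. by move=> ik; apply: gen_subgroup_sub; exists i. Qed.

(** The right translate A g, so that cosets H g compose with multiplication on the right. The form
    with g^-1 avoids an existential. *)
Definition translate (A : set G) (g : G) : set G := [set a | A (a * g^-1)]%classic.

Lemma translateM A g h : translate A (g * h) = translate (translate A g) h.
Proof. by apply/funext => a; rewrite /translate /= invgM mulgA. Qed.

Lemma translate1 A : translate A 1 = A.
Proof. by apply/funext => a; rewrite /translate /= invg1 mulg1. Qed.

Lemma translateK A B g : translate A g = B -> A = translate B g^-1.
Proof. by move=> <-; rewrite -translateM mulgV translate1. Qed.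

Lemma translate_id (H : set G) g : is_subgroup H -> H g -> translate H g = H.
Proof.
move=> HG Hg; apply/funext => a; apply/propext; split; rewrite /translate /= => Ha.
  by rewrite -[a](mulgVK g); exact: subgroupM.
by case: HG => _; exact.
Qed.

Lemma translate_cube A B C i : i < m ->
  translate A (x i) = B -> translate B (x i) = C -> translate C (x i) = A.
Proof. by move=> im <- <-; rewrite -!translateM ?mulgA x_cube // translate1. Qed.

Section Step.
Variable k : nat.
Hypothesis km : k < m.

(** Coset representatives x_k x_k x_(k-1) x_(k-2) ..., with d factors. The truncated predecessor
    doubles x_k: the 3-cycle of x_k sends k+2 to k+1 and k+1 to k, after which each x_j sends j+1 to
    j. *)
Fixpoint rep d : G := if d is e.+1 then rep e * x (k - e.-1) else 1.

(* The coset of gen_below k in gen_below k.+1 whose elements move k.+2 to p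
   under the action of the generators by 3-cycles. *)
Definition point_coset p : set G := translate (gen_below k) (rep (k.+2 - p)).

Lemma point_coset_last : point_coset k.+2 = gen_below k.
Proof. by rewrite /point_coset subnn translate1. Qed.

Lemma point_coset_penult : point_coset k.+1 = translate (point_coset k.+2) (x k).
Proof. by rewrite point_coset_last /point_coset subSnn /= mul1g subn0. Qed.

Lemma point_coset_rec j : j <= k -> point_coset j = translate (point_coset j.+1) (x j).
Proof.
move=> jk; rewrite /point_coset -translateM; congr (translate _ _).
have -> : k.+2 - j = (k - j).+2 by lia.
have -> : k.+2 - j.+1 = (k - j).+1 by lia.
by rewrite /=; congr (_ * x _); lia.
Qed.

(** The last condition keeps the claim among points at least j: either the 3-cycle of x_i lives
    there, or all its points lie below p. At j = 0 it is automatic. *)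
Lemma point_coset_action_from j : j <= k.+1 -> forall i p, i <= k -> j <= p -> p <= k.+2 ->
  (j <= i) || (i.+2 < p) -> translate (point_coset p) (x i) = point_coset (cycle3 i p).
Proof.
move=> jk; have [d dE] : exists d, j + d = k.+1 by exists (k.+1 - j); lia.
elim: d j dE {jk} => [|d IH] j dE i p ik jp pk ij.
  (* Base case j = k+1: x_i must fix the coset. For p = k+2 it lies in H_k; for p = k+1, (R4) or
     (R3) moves it to the left of x_k, leaving a factor in H_k. *)
  have {ij} ip : i.+2 < p by lia.
  have -> : cycle3 i p = p by rewrite /cycle3; do !case: eqP => //; lia.
  have [pE|pE] : p = k.+2 \/ p = k.+1 by lia.
    by rewrite pE point_coset_last (translate_id (gen_below_group k)) //; apply: gen_below_gen; lia.
  have fixg g : gen_below k g -> translate (point_coset k.+2) g = point_coset k.+2.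
    by move=> Hg; rewrite point_coset_last (translate_id (gen_below_group k)).
  have xi : gen_below k (x i) by apply: gen_below_gen; lia.
  rewrite pE point_coset_penult -translateM.
  have [iE|i_lt] : i.+2 = k \/ i.+2 < k by lia.
    rewrite -iE -x_braid; last by lia.
    rewrite iE translateM fixg //; apply: (subgroupM (gen_below_group k)) => //.
    by apply: (subgroupV (gen_below_group k)); apply: gen_below_gen; lia.
  by rewrite -x_far_commute // translateM fixg.
have {}IH i' p' : i' <= k -> j < p' -> p' <= k.+2 -> (j < i') || (i'.+2 < p') ->
    translate (point_coset p') (x i') = point_coset (cycle3 i' p').
  by move=> *; apply: (IH j.+1) => //; lia.
have jk : j <= k by lia.
have Cj := esym (point_coset_rec jk).
have fixC i' p' : i' <= k -> j < p' -> p' <= k.+2 -> (j < i') || (i'.+2 < p') ->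
    (p' < i') || (i'.+2 < p') -> translate (point_coset p') (x i') = point_coset p'.
  by move=> *; rewrite IH //; congr point_coset; rewrite /cycle3; do !case: eqP => //; lia.
have C0 i' : j < i' -> i' <= k -> translate (point_coset i') (x i') = point_coset i'.+2.
  by move=> ? ?; rewrite IH //; try lia; congr point_coset;
    rewrite /cycle3; do !case: eqP => //; lia.
have C1 i' : j < i' -> i' <= k -> translate (point_coset i'.+1) (x i') = point_coset i'.
  by move=> ? ?; rewrite IH //; try lia; congr point_coset;
    rewrite /cycle3; do !case: eqP => //; lia.
have C2 i' : j < i' -> i' <= k -> translate (point_coset i'.+2) (x i') = point_coset i'.+1.
  by move=> ? ?; rewrite IH //; try lia; congr point_coset;
    rewrite /cycle3; do !case: eqP => //; lia.
have Cj2 : translate (point_coset j.+2) (x j) = point_coset j.+1.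
  have [->|j_lt] : j = k \/ j < k by lia.
    by rewrite -point_coset_penult.
  (* (x_j x_(j+1))^2 = 1 and the coset of j.+3 is fixed by x_j *)
  have E : x j.+1 * x j = (x j)^-1 * (x j.+1)^-1.
    by apply: mul_square1V; apply: x_mul_square; lia.
  rewrite -(C2 j.+1) //.
  rewrite -translateM E translateM.
  rewrite -(translateK (fixC j j.+3 _ _ _ _ _)) //; try lia.
  by symmetry; apply: translateK; rewrite C0.
have Cj0 : translate (point_coset j) (x j) = point_coset j.+2.
  exact: (translate_cube (leq_ltn_trans jk km) Cj2 Cj).
(* Only p = j and i = j are new; the rest is the induction hypothesis. For p = j, each relation
   moves x_i past the x_j that links C_j to cosets already understood. *)
have [pj|pj] : p = j \/ j < p by lia.
  subst p; have [ijE|[ijE|[ijE|[ijE|ijE]]]] :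
    i.+2 < j \/ i = j \/ i = j.+1 \/ i = j.+2 \/ j.+2 < i by lia.
  - have -> : cycle3 i j = j by rewrite /cycle3; do !case: eqP => //; lia.
    rewrite -Cj -translateM -x_far_commute //; last by lia.
    by rewrite translateM fixC //; lia.
  - by subst i; rewrite Cj0 /cycle3 eqxx.
  - subst i; have -> : cycle3 j.+1 j = j by rewrite /cycle3; do !case: eqP => //; lia.
    (* By (R2), C_(j+1) x_j x_(j+1) follows the path j+1, j+2, j under the two inverses. *)
    have E : x j * x j.+1 = (x j.+1)^-1 * (x j)^-1.
      by apply: mul_square1; apply: x_mul_square; lia.
    rewrite -{1}Cj -translateM E translateM -(translateK (C1 j.+1 _ _)) //.
    by rewrite -(translateK Cj0).
  - subst i; have -> : cycle3 j.+2 j = j by rewrite /cycle3; do !case: eqP => //; lia.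
    (* This is (R4) conjugated by x_j; starting from C_(j+2) it gives the path j+2, j+3, j+2, j. *)
    have E : (x j)^-1 * x j.+2 = (x j.+1)^-1 * x j.+2 * (x j)^-1.
      apply: (mulIg (x j)); rewrite mulgVK; apply: (mulgI (x j)).
      by rewrite !mulgA x_braid ?mulgV ?mul1g //; lia.
    rewrite {1}(translateK Cj0) -translateM E !translateM.
    rewrite -(translateK (C2 j.+1 _ _)) //; last by lia.
    by rewrite C1 // -(translateK Cj0).
  - have -> : cycle3 i j = j by rewrite /cycle3; do !case: eqP => //; lia.
    rewrite -Cj -translateM x_far_commute //; last by lia.
    by rewrite translateM fixC //; lia.
have [->|ijE] : i = j \/ (j < i) || (i.+2 < p) by lia.
  have [pE|[pE|pE]] : p = j.+1 \/ p = j.+2 \/ j.+2 < p by lia.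
  - by rewrite pE Cj; congr point_coset; rewrite /cycle3; do !case: eqP => //; lia.
  - by rewrite pE Cj2; congr point_coset; rewrite /cycle3; do !case: eqP => //; lia.
  by apply: IH => //; lia.
by apply: IH => //; lia.
Qed.

Lemma point_coset_action i p : i <= k -> p <= k.+2 ->
  translate (point_coset p) (x i) = point_coset (cycle3 i p).
Proof. by move=> ik pk; apply: (@point_coset_action_from 0). Qed.

End Step.
End Cosets.

(** * The 3-cycles satisfy (R1)-(R4) *)

Section ThreeCycles.
Variable n : nat.
Local Notation "i '%:I'" := (inord i : 'I_n.+1) (at level 2, format "i '%:I'").

Definition three_cycle (i : nat) : {perm 'I_n.+1} :=
  tperm (i%:I) (i.+1%:I) * tperm (i.+1%:I) (i.+2%:I).

Lemma inord_eq i j : i <= n -> j <= n -> (i%:I == j%:I) = (i == j).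
Proof. by move=> ni nj; rewrite -val_eqE /= !inordK. Qed.

Lemma three_cycleE i (p : 'I_n.+1) : i.+2 <= n -> three_cycle i p = cycle3 i p :> nat.
Proof.
move=> ni; rewrite -{1}[p]inord_val; have := ltn_ord p.
move: (nat_of_ord p) => q qn; rewrite permM /cycle3.
have [->|qi] := eqVneq q i; first by rewrite !tpermL inordK.
have [->|qi1] := eqVneq q i.+1.
  by rewrite tpermR tpermD ?inordK ?inord_eq //; lia.
have [->|qi2] := eqVneq q i.+2.
  by rewrite [tperm (inord i) _ _]tpermD ?tpermR ?inordK ?inord_eq //; lia.
by rewrite [tperm (inord i) _ _]tpermD ?tpermD ?inordK ?inord_eq //; lia.
Qed.

Lemma three_cycle_even i : i.+2 <= n -> three_cycle i \in 'Alt_('I_n.+1).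
Proof. by move=> ni; rewrite Alt_even odd_permM !odd_tperm !inord_eq //; lia. Qed.

Lemma three_cycleJ i j (s : {perm 'I_n.+1}) :
  (forall p, i <= p <= i.+2 -> s (p%:I) = (j + (p - i))%:I) ->
  three_cycle i ^ s = three_cycle j.
Proof.
move=> sE; rewrite conjMg !tpermJ !sE; try lia.
by rewrite subnn subSnn -addn2 addKn addn0 addn1 addn2.
Qed.

Variant cycle3_spec i p : nat -> Type :=
  | Cycle3First of p = i : cycle3_spec i p i.+2
  | Cycle3Second of p = i.+1 : cycle3_spec i p i
  | Cycle3Third of p = i.+2 : cycle3_spec i p i.+1
  | Cycle3Fixed of (p < i) || (i.+2 < p) : cycle3_spec i p p.

Lemma cycle3P i p : cycle3_spec i p (cycle3 i p).
Proof. by rewrite /cycle3; do !case: eqP => ?; constructor => //; lia. Qed.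

(** Innermost applications are split first, so that each split has an argument free of [cycle3];
    impossible branches are closed at once. *)
Ltac cycle3_cases :=
  repeat match goal with |- context [cycle3 ?i ?p] =>
    lazymatch p with
    | context [cycle3 _ _] => fail
    | _ => case: (cycle3P i p) => ?; try (exfalso; lia)
    end
  end; lia.

Lemma three_cycle_cube i : i.+2 <= n -> three_cycle i * three_cycle i * three_cycle i = 1.
Proof.
move=> ni; apply/permP => p; apply: val_inj.
move: (three_cycle i) (fun q => three_cycleE q ni) => s sE.
by rewrite !permM perm1 /= !sE; cycle3_cases.
Qed.

Lemma three_cycle_mul_square i : i.+3 <= n ->
  three_cycle i * three_cycle i.+1 * three_cycle i * three_cycle i.+1 = 1.
Proof.
move=> ni; apply/permP => p; apply: val_inj.
move: (three_cycle i) (fun q => three_cycleE q (ltnW ni)) => s sE.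
move: (three_cycle i.+1) (fun q => three_cycleE q ni) => t tE.
by rewrite !permM perm1 /= !(sE, tE); cycle3_cases.
Qed.

Lemma three_cycle_commute i j : i.+2 < j -> j.+2 <= n ->
  three_cycle i * three_cycle j = three_cycle j * three_cycle i.
Proof.
move=> ij nj; have ni : i.+2 <= n by lia.
apply/permP => p; apply: val_inj.
move: (three_cycle i) (fun q => three_cycleE q ni) => s sE.
move: (three_cycle j) (fun q => three_cycleE q nj) => t tE.
by rewrite !permM /= !(sE, tE); cycle3_cases.
Qed.

Lemma three_cycle_braid i : i.+4 <= n ->
  three_cycle i * (three_cycle i.+1)^-1 * three_cycle i.+2 =
  three_cycle i.+2 * three_cycle i.
Proof.
(* [cycle3] describes the 3-cycle but not its inverse, so the inverse is replaced by the square. *)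
move=> ni; have -> : (three_cycle i.+1)^-1 = three_cycle i.+1 * three_cycle i.+1.
  by apply: mulg1_eq; rewrite mulgA three_cycle_cube //; lia.
apply/permP => p; apply: val_inj.
have [ni2 ni3] : i.+2 <= n /\ i.+3 <= n by lia.
move: (three_cycle i) (fun q => three_cycleE q ni2) => s sE.
move: (three_cycle i.+1) (fun q => three_cycleE q ni3) => t tE.
move: (three_cycle i.+2) (fun q => three_cycleE q ni) => u uE.
by rewrite !permM /= !(sE, tE, uE); cycle3_cases.
Qed.

End ThreeCycles.

(** * Kernel and image of the permutation representation *)

Section Faithful.
Variables (G : groupType) (x : nat -> G) (m n : nat).
Hypothesis mn : m < n.
Hypothesis x_cube : forall i, i < m -> x i * x i * x i = 1.
Hypothesis x_mul_square : forall i, i.+1 < m -> x i * x i.+1 * x i * x i.+1 = 1.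
Hypothesis x_far_commute : forall i j, i.+2 < j -> j < m -> x i * x j = x j * x i.
Hypothesis x_braid : forall i, i.+2 < m -> x i * (x i.+1)^-1 * x i.+2 = x i.+2 * x i.

Variable phi : G -> {perm 'I_n.+1}.
Hypothesis phiM : {morph phi : g h / g * h}.
Hypothesis phi_x : forall i, i < m -> phi (x i) = three_cycle n i.

Let phi1 : phi 1 = 1 := mul_morph1 phiM.
Let phiV : {morph phi : g / g^-1} := mul_morphV phiM.

Let phiE i p : i < m -> phi (x i) p = cycle3 i p :> nat.
Proof. by move=> im; rewrite phi_x ?three_cycleE //; lia. Qed.

(** Stability of {0, ..., k+2} is stated as an equality of booleans so that it passes to inverses,
    which makes the elements with this property a subgroup. *)
Lemma point_coset_gen_action k g : k < m -> gen_below x k.+1 g -> forall p : 'I_n.+1,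
  (phi g p <= k.+2) = (p <= k.+2) /\
  (p <= k.+2 -> translate (point_coset x k p) g = point_coset x k (phi g p)).
Proof.
move=> km; move: g; apply: gen_subgroup_min; first split.
- by move=> p; rewrite phi1 perm1 translate1.
- move=> a b Qa Qb p; rewrite phiM phiV permM translateM.
  have [ka Ca] := Qa p; have [] := Qb ((phi b)^-1 (phi a p)); rewrite permKV => kb Cb.
  split=> [|kp]; first by rewrite -kb ka.
  by rewrite Ca //; symmetry; apply: translateK; rewrite Cb // -kb ka.
move=> _ [i /= ik <-] p; have im := leq_ltn_trans (ik : i <= k) km; rewrite !phiE //.
split; first by rewrite /cycle3; do !case: eqP => //; lia.
by move=> pk; apply: point_coset_action x_cube x_mul_square x_far_commute x_braid _ _ _ _ _ _.
Qed.

Lemma gen_below_faithful k g : k <= m -> gen_below x k g -> phi g = 1 -> g = 1.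
Proof.
elim: k g => [|k IH] g km gk phig.
  suff: (gen_below x 0 `<=` [set 1 : G])%classic by apply.
  apply: gen_subgroup_min; last by move=> h [].
  by split=> // a b -> ->; rewrite mulgV.
apply: IH => //; first exact: ltnW.
have pk : k.+2 < n.+1 by lia.
have [_] := point_coset_gen_action km gk (Ordinal pk).
(* The equality H_k g = H_k, read at the element g, says that g lies in H_k. *)
rewrite phig perm1 /= point_coset_last => /(_ (leqnn _)) /(congr1 (fun A : set G => A g)).
rewrite /translate /= mulgV => <-; exact: (gen_below_group x k).1.
Qed.

(** For p <= k, x_p raises p by two; if this climb reaches k+1, the square of x_k finishes it
    through k+1, k, k+2. *)
Lemma gen_below_transitive k (p : 'I_n.+1) : k < m -> p <= k.+2 ->
  exists2 g, gen_below x k.+1 g & phi g p = k.+2 :> nat.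
Proof.
move=> km; have [d dE] : exists d, d = k.+2 - p by eexists.
have genM := subgroupM (gen_below_group x k.+1).
have xg i : i <= k -> gen_below x k.+1 (x i) by move=> ?; apply: gen_below_gen.
elim/ltn_ind: d p dE => d IH p dE pk.
have [pE|pk'] : p = k.+2 :> nat \/ p < k.+2 by lia.
  by exists 1; [exact: (gen_below_group x k.+1).1|rewrite phi1 perm1].
have [pE|pk2] : p = k.+1 :> nat \/ p <= k by lia.
  exists (x k * x k); first by apply: genM; exact: xg.
  by rewrite phiM permM !phiE // pE /cycle3; do !case: eqP => //; lia.
have pm : p < m by lia.
have xpE : phi (x p) p = p.+2 :> nat by rewrite phiE // /cycle3 eqxx.
have [||g gk gE] := IH _ _ (phi (x p) p) erefl; try by rewrite xpE; lia.
exists (x p * g); first by apply: genM => //; apply: xg.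
by rewrite phiM permM.
Qed.

Lemma gen_below_fix k g : k <= m -> gen_below x k g ->
  forall p : 'I_n.+1, k.+1 < p -> phi g p = p.
Proof.
move=> km; move: g; apply: gen_subgroup_min; first split.
- by move=> p; rewrite phi1 perm1.
- move=> a b Fa Fb p kp; rewrite phiM phiV permM Fa //.
  by rewrite -{1}(Fb p kp) permK.
move=> _ [i /= ik <-] p kp; apply: val_inj; rewrite /= phiE; last by lia.
by rewrite /cycle3; do !case: eqP => //; lia.
Qed.

(** Induction along the stabilizer chain: an element of H_(k+1) brings the image of k+2 back to k+2,
    and the product is handled in H_k. *)
Lemma even_in_gen_below k (s : {perm 'I_n.+1}) : k <= m -> ~~ odd_perm s ->
  (forall p : 'I_n.+1, k.+1 < p -> s p = p) -> exists2 g, gen_below x k g & phi g = s.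
Proof.
elim: k s => [|k IH] s km s_even s_fix.
  exists 1; first exact: (gen_below_group x 0).1.
  rewrite phi1; case: (altP (s =P 1)) s_even => [-> //|s_neq1].
  (* A permutation supported on {0, 1} other than 1 is the transposition, which is odd. *)
  suff -> : s = tperm (inord 0) (inord 1) by rewrite odd_tperm inord_eq //; lia.
  have s_stable (p : 'I_n.+1) : p <= 1 -> s p <= 1.
    move=> p1; rewrite leqNgt; apply/negP => sp.
    by have /perm_inj spE := s_fix _ sp; rewrite spE in sp; lia.
  have s01 : s (inord 0) != s (inord 1) by rewrite (inj_eq perm_inj) inord_eq //; lia.
  have ord01 (p : 'I_n.+1) : p <= 1 -> p = inord 0 \/ p = inord 1.
    by case: p => [[|[|]]] //= ? _; [left|right]; apply: val_inj; rewrite /= inordK.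
  have [s0 s1] : s (inord 0) = inord 1 /\ s (inord 1) = inord 0.
    have s0_le : s (inord 0) <= 1 by apply: s_stable; rewrite inordK.
    have s1_le : s (inord 1) <= 1 by apply: s_stable; rewrite inordK //; lia.
    have [s0|s0] := ord01 _ s0_le; have [s1|s1] := ord01 _ s1_le => //.
    - by rewrite s0 s1 eqxx in s01.
    - case/negP: s_neq1; apply/eqP/permP => p; rewrite perm1.
      by case: (ltnP 1 p) => [/s_fix //|/ord01 [] ->].
    - by rewrite s0 s1 eqxx in s01.
  apply/permP => p; case: (ltnP 1 p) => [p1|/ord01 [] ->]; last 2 first.
  - by rewrite tpermL.
  - by rewrite tpermR.
  by rewrite s_fix // tpermD // -val_eqE /= inordK //; lia.
have pk : k.+2 < n.+1 by lia.
(* All larger points are fixed, so injectivity forbids sending k+2 to one of them. *)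
have spk : s (Ordinal pk) <= k.+2.
  rewrite leqNgt; apply/negP => sp.
  by have /perm_inj spE := s_fix _ sp; rewrite spE /= ltnn in sp.
have [g gk gE] := gen_below_transitive km spk.
have [||h hk hE] := IH (s * phi g) (ltnW km).
- have phi_even : phi g \in 'Alt_('I_n.+1).
    move: g gk {gE}; apply: gen_subgroup_min; first split=> [|a b].
    + by rewrite /= phi1 group1.
    + by move=> /= Ha Hb; rewrite phiM phiV groupM ?groupV.
    by move=> _ [i /= ik <-]; rewrite phi_x ?three_cycle_even //; lia.
  by rewrite Alt_even in phi_even; rewrite odd_permM (negbTE s_even) (negbTE phi_even).
- move=> p kp; have [pE|pk2] : p = k.+2 :> nat \/ k.+2 < p by lia.
    have -> : p = Ordinal pk by exact: val_inj.
    by apply: val_inj; rewrite /= permM gE.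
  by rewrite permM s_fix // (gen_below_fix km gk).
exists (h * g^-1); last by rewrite phiM phiV hE mulgK.
apply: (subgroupM (gen_below_group x k.+1)); last exact: (subgroupV (gen_below_group x k.+1)).
move: hk; apply: sub_smallest2r; first exact: gen_subgroup_group.
by move=> _ [i /= ik <-]; exists i => //=; lia.
Qed.

End Faithful.

(** * The isomorphism of S_n^+ with A_n, and locality *)

Section SplusAlt.
Variable n : nat.
Hypothesis n_gt0 : 0 < n.
Local Notation m := (n.+1 - 2).
Local Notation S := (Splus n.+1).
Local Notation gen := (pres_gen (@Splus_rel n.+1)).

(** The generators reindexed by [nat] to fit the coset argument, with default value 1 outside the
    range. *)
Definition Splus_gen (i : nat) : S := oapp gen 1 (insub i).

Lemma Splus_genE (i : 'I_m) : Splus_gen i = gen i.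
Proof. by rewrite /Splus_gen valK. Qed.

Lemma Splus_gen_cube i : i < m -> Splus_gen i * Splus_gen i * Splus_gen i = 1.
Proof.
move=> im; have := presented_rel (Splus_R1 (Ordinal im)).
by rewrite /word_val !big_cons big_nil /= mulg1 mulgA -Splus_genE.
Qed.

Lemma Splus_gen_mul_square i : i.+1 < m ->
  Splus_gen i * Splus_gen i.+1 * Splus_gen i * Splus_gen i.+1 = 1.
Proof.
move=> im; have := presented_rel (@Splus_R2 n.+1 (Ordinal (ltnW im)) (Ordinal im) erefl).
by rewrite /word_val !big_cons big_nil /= mulg1 !mulgA -!Splus_genE.
Qed.

Lemma Splus_gen_commute i j : i.+2 < j -> j < m ->
  Splus_gen i * Splus_gen j = Splus_gen j * Splus_gen i.
Proof.
move=> ij jm; have im : i < m by lia.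
have /= := @Splus_R3 n.+1 (Ordinal im) (Ordinal jm).
have -> : 2 < `|i - j| by lia.
move=> /(_ isT)/presented_rel.
by rewrite /word_val !big_cons big_nil /= !mulg1 -!Splus_genE.
Qed.

Lemma Splus_gen_braid i : i.+2 < m ->
  Splus_gen i * (Splus_gen i.+1)^-1 * Splus_gen i.+2 = Splus_gen i.+2 * Splus_gen i.
Proof.
move=> im; have [im0 im1] : i < m /\ i.+1 < m by lia.
have := presented_rel
  (@Splus_R4 n.+1 (Ordinal im0) (Ordinal im1) (Ordinal im) erefl erefl).
by rewrite /word_val !big_cons big_nil /= !mulg1 mulgA -!Splus_genE.
Qed.

Lemma Splus_perm : exists phi : {multiplicative S -> {perm 'I_n.+1}},
  forall i, phi (gen i) = three_cycle n i.
Proof.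
apply: presented_lift => l r; case=> {l r}.
- move=> i; rewrite /word_val !big_cons big_nil /= mulg1 mulgA.
  by apply: three_cycle_cube; have := ltn_ord i; lia.
- move=> i j ij; rewrite /word_val !big_cons big_nil /= mulg1 2!mulgA ij.
  by apply: three_cycle_mul_square; have := ltn_ord j; lia.
- move=> i j ij; rewrite /word_val !big_cons big_nil /= !mulg1.
  have := ltn_ord i; have := ltn_ord j; have [? ? ?|? ? ?] : i.+2 < j \/ j.+2 < i by lia.
    by apply: three_cycle_commute; lia.
  by symmetry; apply: three_cycle_commute; lia.
move=> i j k ij ik; rewrite /word_val !big_cons big_nil /= !mulg1 mulgA ij ik.
by apply: three_cycle_braid; have := ltn_ord k; lia.
Qed.

Lemma Splus_perm_bij : exists phi : {multiplicative S -> {perm 'I_n.+1}},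
  [/\ forall i, phi (gen i) = three_cycle n i, injective phi,
      forall g, phi g \in 'Alt_('I_n.+1)
    & forall s, s \in 'Alt_('I_n.+1) -> exists g, phi g = s].
Proof.
have [phi phi_gen] := Splus_perm; exists phi.
have phiM : {morph phi : g h / g * h} by exact: gmulfM.
have phi1 := mul_morph1 phiM; have phiV := mul_morphV phiM.
have phi_x i : i < m -> phi (Splus_gen i) = three_cycle n i.
  by move=> im; rewrite (Splus_genE (Ordinal im)) phi_gen.
have mn : m < n by lia.
have gen_all g : gen_below Splus_gen m g.
  apply: presented_ind; first exact: gen_below_group.
  by move=> i; rewrite -Splus_genE; apply: gen_below_gen.
split=> //.
- move=> g h gh; apply: divg1_eq.
  apply: (gen_below_faithful mn Splus_gen_cube Splus_gen_mul_square
            Splus_gen_commute Splus_gen_braid phiM phi_x (leqnn m)) => //.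
  by rewrite phiM phiV gh mulgV.
- apply: presented_ind; first split=> [|a b].
  + by rewrite phi1 group1.
  + by move=> Ha Hb; rewrite phiM phiV groupM ?groupV.
  by move=> i; rewrite phi_gen three_cycle_even //; have := ltn_ord i; lia.
move=> s; rewrite Alt_even => s_even.
have [|g _ <-] := even_in_gen_below mn phiM phi_x (leqnn m) s_even; last by exists g.
(* Here m.+1 = n, the largest point, so the support condition is vacuous. *)
by move=> p; have := ltn_ord p; lia.
Qed.

Lemma Splus_isomorphic_Alt : isomorphic S [subg 'Alt_('I_n.+1)]%type.
Proof.
have [phi [_ phi_inj phi_even phi_surj]] := Splus_perm_bij.
pose f (g : S) : [subg 'Alt_('I_n.+1)] := subg _ (phi g).
have fM : {morph f : g h / g * h}.
  by move=> g h; apply: val_inj; rewrite /= !subgK ?gmulfM ?groupM.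
pose fmixin := isMultiplicative.Build _ _ f fM.
pose F : {multiplicative S -> [subg 'Alt_('I_n.+1)]} := HB.pack f fmixin.
exists F.
have fE g : sgval (f g) = phi g by rewrite subgK.
have inv_f (s : [subg 'Alt_('I_n.+1)]) : {g | phi g = sgval s}.
  by apply: cid; apply: phi_surj; apply: subgP.
exists (fun s => projT1 (inv_f s)).
  by move=> g; apply: phi_inj; case: inv_f => h /= ->; rewrite fE.
by move=> s; apply: val_inj; case: inv_f => h /= hs; rewrite -hs; exact: fE.
Qed.

Lemma Splus_local : local_gens 3 gen.
Proof.
move=> i j ij; have [ij3|ij3] : i.+2 < j \/ j.+2 < i by lia.
  by rewrite -!Splus_genE Splus_gen_commute.
by rewrite -!Splus_genE (Splus_gen_commute ij3).
Qed.

End SplusAlt.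

(** * Stationarity *)

Lemma gen_subgroup_bij (G : groupType) (A B : set G) (f f' : G -> G) :
  {morph f : a b / a * b} -> {morph f' : a b / a * b} -> cancel f f' -> cancel f' f ->
  (forall a, A a -> B (f a)) -> (forall b, B b -> A (f' b)) ->
  set_bij (gen_subgroup A) (gen_subgroup B) f.
Proof.
move=> fM f'M fK f'K AB BA.
have genP C D (h : G -> G) : {morph h : a b / a * b} -> (forall a, C a -> D (h a)) ->
    forall a, gen_subgroup C a -> gen_subgroup D (h a).
  move=> hM CD; apply: gen_subgroup_min.
    by apply: preimage_subgroup hM _; exact: gen_subgroup_group.
  by move=> a /CD; exact: gen_subgroup_sub.
split; first by move=> a; apply: genP.
  by move=> a b _ _; apply: (can_inj fK).
by move=> b Hb; exists (f' b); [exact: (genP B A)|].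
Qed.

(** The isomorphism between windows is the restriction of an automorphism of the whole group, namely
    conjugation by [rot] seen through phi. *)
Lemma Splus_stationary n : 0 < n -> stationary_gens 3 (pres_gen (@Splus_rel n.+1)).
Proof.
move=> n_gt0 i im.
have [phi [phi_gen phi_inj phi_even phi_surj]] := Splus_perm_bij n_gt0.
have phiM : {morph phi : g h / g * h} by exact: gmulfM.
have inv_phi s : {g | s \in 'Alt_('I_n.+1) -> phi g = s}.
  apply: cid; case: (boolP (s \in _)) => [/phi_surj [g gE]|_]; first by exists g.
  by exists 1.
pose psi s := projT1 (inv_phi s).
have psiK s : s \in 'Alt_('I_n.+1) -> phi (psi s) = s by exact: (projT2 (inv_phi s)).
(* The shift by i in the cyclic group of order n+1. The first three generators move only the points
   0, ..., 4, and i+4 <= n, so no wraparound occurs on them. *)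
pose rot : {perm 'I_n.+1} := perm (@mulgI 'I_n.+1 (inord i)).
have AltJ s t : s \in 'Alt_('I_n.+1) -> s ^ t \in 'Alt_('I_n.+1).
  by rewrite !Alt_even odd_permJ.
pose f t g := psi (phi g ^ t).
have phi_f t g : phi (f t g) = phi g ^ t by rewrite psiK ?AltJ.
have fM t : {morph f t : a b / a * b}.
  by move=> a b; apply: phi_inj; rewrite phi_f !phiM !phi_f conjMg.
have fK s t : s * t = 1 -> cancel (f s) (f t).
  by move=> st g; apply: phi_inj; rewrite !phi_f -conjgM st conjg1.
have f_gen (j j' : 'I_(n.+1 - 2)) : j < 3 -> j' = j + i :> nat -> 
  f rot (pres_gen _ j) = pres_gen _ j'.
- move=> j3 j'E; apply: phi_inj; rewrite phi_f !phi_gen.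
  apply: three_cycleJ => p pj; apply: val_inj.
  rewrite permE /= /mul /= !inordK ?modn_small; lia.
have f_genV (j j' : 'I_(n.+1 - 2)) : j < 3 -> j' = j + i :> nat -> 
  f rot^-1 (pres_gen _ j') = pres_gen _ j.
- by move=> j3 j'E; rewrite -(f_gen j) // fK ?mulgV.
exists (f rot); split=> [a b _ _||j j' j3 j'E]; [exact: fM| |exact: f_gen].
apply: (gen_subgroup_bij (f' := f rot^-1)) => //; try by apply: fK; rewrite ?mulVg ?mulgV.
- move=> _ [j /= j3 <-]; have ji : j + i < n.+1 - 2 by lia.
  exists (Ordinal ji) => /=; first by lia.
  by rewrite (f_gen _ (Ordinal ji)).
move=> _ [j /= j3 <-]; have ji : j - i < n.+1 - 2 by have := ltn_ord j; lia.
exists (Ordinal ji) => /=; first by lia.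
by rewrite (f_genV (Ordinal ji)) //=; lia.
Qed.

(** * The two-generator presentation of A_4 *)

Lemma Splus4_A4 : exists f : {multiplicative Splus 4 -> presented A4_rel},
  bijective f /\ forall i : 'I_2, f (pres_gen (@Splus_rel 4) i) = pres_gen A4_rel i.
Proof.
have ordE (i : 'I_2) : i = ord0 \/ i = ord_max.
  by case: i => [[|[|]]] //= ?; [left|right]; apply: val_inj.
have [f fE] : exists f : {multiplicative Splus 4 -> presented A4_rel},
    forall i, f (pres_gen (@Splus_rel 4) i) = pres_gen A4_rel i.
  apply: (@presented_lift _ _ _ (pres_gen A4_rel)) => l r; case=> {l r}.
  - move=> i; apply: presented_rel.
    by have [] := ordE i => ->; [apply: A4_x1_cubed | apply: A4_x2_cubed].
  - move=> i j; have [] := ordE i => ->; have [] := ordE j => -> //= _.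
    by apply: presented_rel; apply: A4_x1x2_squared.
  (* With two generators, (R3) and (R4) have no instances. *)
  - by move=> i j; have [] := ordE i => ->; have [] := ordE j => ->.
  by move=> i j k; have [] := ordE i => ->; have [] := ordE k => ->.
have [g gE] : exists g : {multiplicative presented A4_rel -> Splus 4},
    forall i, g (pres_gen A4_rel i) = pres_gen (@Splus_rel 4) i.
  apply: presented_lift => l r; case=> {l r}; apply: presented_rel.
  - exact: Splus_R1.
  - exact: Splus_R1.
  exact: (@Splus_R2 4).
(* An endomorphism fixing the generators is the identity; applied to both composites, this makes f
   and g mutually inverse. *)
have fixed_gens_id (I : choiceType) (R : word I -> word I -> Prop)
    (h : presented R -> presented R) : {morph h : a b / a * b} ->
    (forall i, h (pres_gen R i) = pres_gen R i) -> forall a, h a = a.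
  move=> hM h_gen; apply: presented_ind => //; split; first exact: mul_morph1.
  by move=> a b ha hb; rewrite hM mul_morphV // ha hb.
exists f; split=> //; exists g.
  apply: (fixed_gens_id _ _ (g \o f)) => [a b|i]; first by rewrite /= !gmulfM.
  by rewrite /= fE gE.
apply: (fixed_gens_id _ _ (f \o g)) => [a b|i]; first by rewrite /= !gmulfM.
by rewrite /= gE fE.
Qed.

Local Close Scope group_scope.

Theorem theorem1 :
  (forall n : nat, (5 <= n)%N ->
     isomorphic (Splus n) [subg 'Alt_('I_n)]
     /\ stationary_local_presentation 3 (@Splus_rel n))
  /\ isomorphic (Splus 4) [subg 'Alt_('I_4)]
  /\ exists f : {multiplicative Splus 4 -> presented A4_rel},
       bijective f /\
       forall i : 'I_2, f (pres_gen (@Splus_rel 4) i) = pres_gen A4_rel i.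
Proof.
split; last by split; [exact: Splus_isomorphic_Alt | exact: Splus4_A4].
case=> // n n5; have n_gt0 : 0 < n by lia.
split; first exact: Splus_isomorphic_Alt.
by split; [exact: Splus_local | exact: Splus_stationary].
Qed.
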